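(* Let $G$ be a finite group whose Sylow $2$-subgroups are extraspecial of order $2^{2m+1}$ ($m\geqslant 1$), and let $H\leqslant G$. Let $G_2$, $H_2$ and $N_G(H_2)_2$ denote Sylow $2$-subgroups of $G$, $H$ and $N_G(H_2)$, respectively. Then $H$ is a perfect code of $G$ if and only if either $|H|$ is odd or one of the following holds: (1) $H_2$ is non-abelian; (2) $H_2$ is abelian and $|N_G(H_2)_2|<|G_2|$; (3) $H_2$ is abelian, $|H_2|^2=2|G_2|$ and $G_2\cong G_{m,1}$.
   Context: All groups are finite; all graphs are finite, undirected and simple. For a group $G$ and an inverse-closed subset $S\subseteq G\setminus\{1\}$, the Cayley graph $\mathrm{Cay}(G,S)$ has vertex set $G$, with $x,y\in G$ adjacent if and only if $yx^{-1}\in S$. A subset $C$ of the vertex set of a graph $\Gamma$ is a perfect code in $\Gamma$ if $C$ is an independent set and every vertex of $\Gamma$ is at distance at most $1$ from exactly one vertex of $C$. A subgroup $H$ of a group $G$ is called a perfect code of $G$ if there exists a Cayley graph $\mathrm{Cay}(G,S)$ of $G$ in which $H$ is a perfect code. A finite $2$-group $Q$ is extraspecial if its center $Z(Q)$ has order $2$ and $Q/Z(Q)$ is a (nontrivial) elementary abelian $2$-group; then $|Q|=2^{2m+1}$ for some positive integer $m$. For a positive integer $m$, $G_{m,1}$ denotes the central product $D_8\circ\cdots\circ D_8$ of $m$ copies of the dihedral group $D_8$ of order $8$, with all the centers (of order $2$) identified; it is extraspecial of order $2^{2m+1}$. *)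

(* Defs.v *)
From mathcomp Require Import all_boot all_fingroup all_solvable.

Set Implicit Arguments.
Unset Strict Implicit.
Unset Printing Implicit Defensive.

Local Open Scope group_scope.

(* A graph is given by a vertex set V and an adjacency relation e on a finite
   type; [(c == v) || e c v] says that c and v are at distance at most 1. *)
Definition perfect_code (T : finType) (V : {set T}) (e : rel T) (C : {set T}) :
    Prop :=
  [/\ C \subset V,
      {in C &, forall x y, ~~ e x y}
    & {in V, forall v, exists! c, c \in C /\ (c == v) || e c v}].

Definition cayley (gT : finGroupType) (S : {set gT}) : rel gT :=
  fun x y => y * x^-1 \in S.

Definition subgroup_perfect_code (gT : finGroupType) (G H : {group gT}) : Prop :=
  exists S : {set gT},
    [/\ S \subset G^#, {in S, forall s, s^-1 \in S}
      & perfect_code G (cayley S) H].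

(* Central product of m copies of the dihedral group of order 8, all centers
   being identified. *)
Definition Gm1 (m : nat) : finGroupType := ncprod [group of 'D_8] m.

(* For 2-groups, MathComp's [extraspecial] (the Frattini subgroup and the
   derived subgroup both equal the center, which has prime order) is the same
   as: the center has order 2 and the central quotient is a nontrivial
   elementary abelian 2-group. *)
Lemma extraspecial2P (gT : finGroupType) (Q : {group gT}) :
  2.-group Q ->
  extraspecial Q <->
    [/\ #|'Z(Q)| = 2, 2.-abelem (Q / 'Z(Q)) & Q / 'Z(Q) != 1].
Proof.
move=> pQ; split=> [esQ | [oZ abQ ntQ]].
  have [[PhiZ _] _] := esQ; split.
  - exact: card_center_extraspecial pQ esQ.
  - by rewrite -PhiZ Phi_quotient_abelem.
  - apply: contra (extraspecial_nonabelian esQ).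
    rewrite -subG1 quotient_sub1 ?normal_norm ?center_normal // => sQZ.
    exact: abelianS sQZ (center_abelian Q).
have prZ : prime #|'Z(Q)| by rewrite oZ.
have sPhiZ : 'Phi(Q) \subset 'Z(Q).
  by apply: (Phi_min pQ) abQ; exact: normal_norm (center_normal Q).
have sQ'Phi : Q^`(1) \subset 'Phi(Q) by rewrite (Phi_joing pQ) joing_subl.
have Q'Z : Q^`(1) = 'Z(Q).
  apply/eqP; rewrite eqEsubset (subset_trans sQ'Phi sPhiZ) /=.
  apply: contraR ntQ => /(prime_TIg prZ) /eqP.
  rewrite setIC (setIidPl (subset_trans sQ'Phi sPhiZ)) => /eqP/derG1P abelQ.
  have /center_idP -> : abelian Q by [].
  by rewrite trivg_quotient.
split=> //; split=> //; apply/eqP; rewrite eqEsubset sPhiZ /=.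
by rewrite -Q'Z.
Qed.

(* Main.v *)
Require Import Defs.
From mathcomp Require Import all_boot all_fingroup all_solvable.

(* H is a perfect code of G iff its left cosets have an inverse-closed
   transversal T.  Inversion permutes the double cosets HxH, and any two left
   cosets xH, yH with HxH = Hy^-1H can be represented by some t and t^-1; so
   the only obstruction is a self-inverse double coset with an odd number of
   left cosets and no element of square 1.  By Sylow and Frattini arguments
   this reduces to the 2-group N2: H is a perfect code iff every x in N2 with
   x^2 in H2 has xh of square 1 for some h in H2.

   Inside an extraspecial 2-group Q, let q be the squaring form on Q / Z(Q) and
   b its polar form, the commutator.  If H2 is not abelian, q takes the value 0
   on every coset since b is nonzero on H2.  If H2 is not normal, it meets Z(Q)
   trivially, and x^2 in H2 forces x^2 = 1.  If H2 is abelian and contains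
   Z(Q), then q(xh) = q(x) + q(h) + b(x,h) is affine in h, and it is constant
   exactly when b(x,.) = q on H2.  The condition therefore says that q vanishes
   on the set of those x, a coset of C_Q(H2); this makes C_Q(H2) abelian, so
   |H2|^2 = 2|Q|, and provides an elementary abelian subgroup of order |H2|.
   The existence of such a subgroup singles out D_8 o ... o D_8 among the two
   extraspecial groups of order |Q|. *)

Set Implicit Arguments.
Unset Strict Implicit.
Unset Printing Implicit Defensive.

Local Open Scope group_scope.

(** * Perfect codes and inverse-closed transversals *)

(** Inversion pairs off the elements with [a^-1 != a]; removing one such pair preserves parity. *)
Lemma odd_invg_closed_involution (gT : finGroupType) (A : {set gT}) :
    {in A, forall a, a^-1 \in A} -> odd #|A| ->
  exists2 a, a \in A & a ^+ 2 = 1.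
Proof.
have [n] := ubnP #|A|; elim: n => // n IHn in A * => leAn AV oddA.
have [a Aa] : exists a, a \in A.
  by apply/set0Pn; apply: contraTneq oddA => ->; rewrite cards0.
have [aV | neq_aV] := eqVneq a^-1 a.
  by exists a => //; rewrite expgS expg1 -{1}aV mulVg.
have Aa' : a^-1 \in A :\ a by rewrite !inE neq_aV AV.
have cA := cardsD1 a A; rewrite Aa (cardsD1 a^-1 (A :\ a)) Aa' in cA.
have [|||b /setD1P[_ /setD1P[_ Ab]] b2] := IHn (A :\ a :\ a^-1).
- by rewrite cA !add1n ltnS in leAn; apply: ltnW.
- move=> c /setD1P[nca' /setD1P[nca Ac]].
  by rewrite !inE (inj_eq invg_inj) nca (inv_eq invgK) nca' AV.
- by move: oddA; rewrite cA /= negbK.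
by exists b.
Qed.

(** * Double cosets of H *)

Section DoubleCosets.

Variables (gT : finGroupType) (H : {group gT}).

Definition dcoset (x : gT) : {set gT} := H :* x * H.

Lemma dcosetP x y :
  reflect (exists h k, [/\ h \in H, k \in H & y = h * x * k]) (y \in dcoset x).
Proof.
apply: (iffP mulsgP) => [[_ k /rcosetP[h Hh ->] Hk ->] | [h [k [Hh Hk ->]]]].
  by exists h, k.
by exists (h * x) k => //; rewrite mem_rcoset mulgK.
Qed.

Lemma dcoset_refl x : x \in dcoset x.
Proof. by apply/dcosetP; exists 1, 1; rewrite group1 mul1g mulg1. Qed.

Lemma dcoset_mul x y h k :
  h \in H -> k \in H -> (h * y * k \in dcoset x) = (y \in dcoset x).
Proof.
move=> Hh Hk; apply/dcosetP/dcosetP=> -[h' [k' [Hh' Hk' def_y]]].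
  exists (h^-1 * h'), (k' * k^-1); rewrite !groupM ?groupV //; split=> //.
  by rewrite -[y](mulKg h) -[h * y](mulgK k) def_y !mulgA.
exists (h * h'), (k' * k); rewrite !groupM //; split=> //.
by rewrite def_y !mulgA.
Qed.

Lemma dcoset_mulr x y k : k \in H -> (y * k \in dcoset x) = (y \in dcoset x).
Proof. by move=> Hk; rewrite -[y]mul1g dcoset_mul // mul1g. Qed.

Lemma dcoset_eq x y : y \in dcoset x -> dcoset y = dcoset x.
Proof.
case/dcosetP=> h [k [Hh Hk ->]]; apply/setP=> z.
apply/dcosetP/dcosetP=> -[h' [k' [Hh' Hk' ->]]].
  by exists (h' * h), (k * k'); rewrite !groupM // !mulgA.
exists (h' * h^-1), (k^-1 * k'); rewrite !groupM ?groupV //; split=> //.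
by rewrite !mulgA mulgKV mulgK.
Qed.

Lemma dcosetV x y : (y^-1 \in dcoset x) = (y \in dcoset x^-1).
Proof.
apply/dcosetP/dcosetP=> -[h [k [Hh Hk def_y]]]; exists k^-1, h^-1.
  by rewrite !groupV -[y]invgK def_y !invMg mulgA.
by rewrite !groupV def_y !invMg invgK mulgA.
Qed.

Lemma card_dcoset x : (#|dcoset x| * #|H :&: H :^ x| = #|H| * #|H|)%N.
Proof.
have -> : dcoset x = x *: (H :^ x * H).
  by rewrite conjsgE !mulgA mulg_set1 mulgV mul1g.
by rewrite card_lcoset setIC -mul_cardG cardJg.
Qed.

End DoubleCosets.

(** * Inverse-closed transversals of the left cosets of H *)

Section Transversals.

Variables (gT : finGroupType) (H : {group gT}).
Implicit Types (T : {set gT}) (G : {group gT}).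

(** Boolean-valued, so that a maximal such set can be taken; [s^-1 * t \in H] says that sH = tH. *)
Definition partial_transversal T :=
  [forall s in T, forall t in T, (s^-1 * t \in H) ==> (s == t)].

Lemma partial_transversalP T :
  reflect {in T &, forall s t, s^-1 * t \in H -> s = t} (partial_transversal T).
Proof.
apply: (iffP forall_inP) => [trT s t Ts Tt Hst | trT s Ts].
  by apply/eqP; move: Hst; apply/implyP; move/forall_inP: (trT s Ts); apply.
by apply/forall_inP=> t Tt; apply/implyP=> /trT ->.
Qed.

Lemma card_partial_transversal T :
  partial_transversal T -> #|T * H| = (#|T| * #|H|)%N.
Proof.
move/partial_transversalP=> trT.
have -> : T * H = [set st.1 * st.2 | st in setX T H].
  by rewrite -[T * H]/(mulg @2: (T, H)) curry_imset2X; apply: eq_imset => -[].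
rewrite card_in_imset ?cardsX // => -[s h] [t k] /=.
rewrite !inE /= => /andP[Ts Hh] /andP[Tt Hk] eq_shtk.
have eq_st : s = t.
  apply: trT => //; have -> : s^-1 * t = h * k^-1.
    by apply: (mulgI s); rewrite mulKVg mulgA eq_shtk mulgK.
  by rewrite groupM ?groupV.
by move: eq_shtk; rewrite eq_st => /mulgI->.
Qed.

Lemma card_partial_transversal_dcoset T z : partial_transversal T ->
  #|T * H :&: dcoset H z| = (#|T :&: dcoset H z| * #|H|)%N.
Proof.
move/partial_transversalP=> trT; rewrite -card_partial_transversal; last first.
  by apply/partial_transversalP=> s t /setIP[Ts _] /setIP[Tt _]; apply: trT.
congr #|pred_of_set _|; apply/setP=> y; apply/setIP/mulsgP.
  case=> /mulsgP[t h Tt Hh ->] Dy; exists t h => //.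
  by rewrite inE Tt -(dcoset_mulr z t Hh).
case=> t h /setIP[Tt Dt] Hh ->; split; first exact: mem_mulg.
by rewrite dcoset_mulr.
Qed.

Definition inverse_closed_transversal G T :=
  [/\ T \subset G, {in T, forall t, t^-1 \in T}, partial_transversal T
    & G \subset T * H].

Lemma perfect_code_transversal G : H \subset G ->
  subgroup_perfect_code G H <-> exists T, inverse_closed_transversal G T.
Proof.
move=> sHG; split.
  case=> S [sSG SV [_ _ codeH]].
  have nbr v c : (c == v) || cayley S c v = (v * c^-1 \in 1 |: S).
    by rewrite !inE /cayley eq_sym -eq_mulgV1.
  have sTG : 1 |: S \subset G.
    by rewrite subUset sub1G (subset_trans sSG) // subsetDl.
  exists (1 |: S); split=> //.
  - by move=> t /setU1P[->|/SV St]; rewrite ?invg1 ?setU11 // setU1r.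
  - apply/partial_transversalP=> s t Ss St Hst.
    (* Both 1 and [s^-1 * t] are elements of H at distance at most 1 from t, so they coincide. *)
    have [c [_ uc]] := codeH t (subsetP sTG t St).
    have e1 : c = 1 by apply: uc; rewrite group1 nbr invg1 mulg1.
    have eh : c = s^-1 * t by apply: uc; rewrite Hst nbr invMg invgK mulKVg.
    by apply/eqP; rewrite eq_mulVg1 -eh e1.
  apply/subsetP=> v /codeH[c [[Hc]]]; rewrite nbr => Tvc _.
  by apply/mulsgP; exists (v * c^-1) c; rewrite ?mulgKV.
(* The coset H may be represented in T by an element other than 1; discarding T ∩ H makes H
   independent. *)
case=> T [sTG TV /partial_transversalP trT sGTH]; exists (T :\: H); split.
- apply/subsetP=> t /setDP[Tt nHt]; rewrite !inE (subsetP sTG) // andbT.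
  by apply: contraNneq nHt => ->.
- by move=> t /setDP[Tt nHt]; rewrite inE groupV nHt TV.
split=> // [x y Hx Hy | v Gv]; first by rewrite /cayley inE groupM ?groupV.
have [Hv | nHv] := boolP (v \in H).
  exists v; split=> [|c [Hc /predU1P[-> //|]]]; first by rewrite eqxx.
  by rewrite /cayley inE groupM ?groupV.
have /mulsgP[t h Tt Hh def_v] := subsetP sGTH v Gv.
exists h; split=> [|c [Hc /predU1P[cv|]]].
- split=> //; rewrite /cayley inE def_v mulgK Tt andbT orbC.
  by move: nHv; rewrite def_v groupMr // => ->.
- by rewrite -cv Hc in nHv.
rewrite /cayley inE => /andP[_ Tvc]; apply/eqP.
have tvc : t = v * c^-1.
  by apply: trT => //; rewrite def_v !mulgA mulVg mul1g groupM ?groupV.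
by rewrite -(inj_eq (mulgI t)) -def_v tvc mulgKV.
Qed.

Lemma inverse_closed_transversal_exists G : H \subset G ->
    (forall x, x \in G -> x^-1 \in dcoset H x -> odd #|H : H :&: H :^ x| ->
       exists2 s, s \in dcoset H x & s ^+ 2 = 1) ->
  exists T, inverse_closed_transversal G T.
Proof.
move=> sHG invD.
pose P T :=
  [&& T \subset G, [forall t in T, t^-1 \in T] & partial_transversal T].
have P0 : P set0.
  rewrite /P sub0set /=; apply/andP; split.
    by apply/forall_inP=> t; rewrite inE.
  by apply/partial_transversalP=> t s; rewrite inE.
have [T /maxsetP[/and3P[sTG /forall_inP TV trT] maxT] _] := maxset_exists P0.
exists T; split=> //; apply/subsetP=> x Gx; apply: contraT => nTHx.
(* By maximality of T, no pair t, t^-1 can be adjoined. The last premise covers the case where t and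
   t^-1 lie in one left coset, which is exactly [t * t \in H]. *)
have no_ext t : t \in G -> t \notin T * H -> t^-1 \notin T * H ->
    (t * t \in H -> t^-1 = t) -> False.
  move=> Gt nt nt' tt.
  have nTH e : e \in [set t; t^-1] -> e \notin T * H.
    by case/set2P=> ->.
  have nTHl e u : e \in [set t; t^-1] -> u \in T -> u^-1 * e \notin H.
    move=> /nTH ne Tu; apply: contra ne => Hue; apply/mulsgP.
    by exists u (u^-1 * e); rewrite ?mulKVg.
  have defT : [set t; t^-1] :|: T = T.
    apply: maxT; last exact: subsetUr.
    apply/and3P; split.
    - rewrite subUset sTG andbT.
      by apply/subsetP=> _ /set2P[]->; rewrite ?groupV.
    - apply/forall_inP=> e /setUP[/set2P[]->|/TV Te].
      - by rewrite in_setU set22.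
      - by rewrite invgK in_setU set21.
      by rewrite in_setU Te orbT.
    apply/partial_transversalP=> e f /setUP[Ee|Te] /setUP[Ef|Tf].
    - case/set2P: Ee => ->; case/set2P: Ef => ->; rewrite ?invgK //.
      by rewrite -invMg groupV => /tt.
    - by rewrite -groupV invMg invgK (negPf (nTHl e f Ee Tf)).
    - by rewrite (negPf (nTHl f e Ef Te)).
    by move/partial_transversalP: trT; apply.
  have : t \in T by rewrite -defT !inE eqxx.
  by move/(mem_mulg)/(_ (group1 H)); rewrite mulg1 (negPf nt).
have TH_HE u h : h \in H -> (u * h \in T * H) = (u \in T * H).
  move=> Hh; apply/mulsgP/mulsgP=> -[v k Tv Hk def_u].
    by exists v (k * h^-1); rewrite ?groupM ?groupV // mulgA -def_u mulgK.
  by exists v (k * h); rewrite ?groupM // mulgA -def_u.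
have [/exists_inP[s Ds /eqP s2] | no_inv] :=
  boolP [exists s in dcoset H x, s ^+ 2 == 1].
  case/dcosetP: Ds => h [k [Hh Hk def_s]].
  (* Conjugating s = hxk by h in H brings it into the left coset xH. *)
  pose t := x * (k * h).
  have def_t : t = s ^ h by rewrite /t conjgE def_s !mulgA mulVg mul1g.
  have tV : t^-1 = t.
    by apply/eqP; rewrite eq_invg_mul -[t * t]/(t ^+ 2) def_t -conjXg s2 conj1g.
  have nt : t \notin T * H by rewrite TH_HE ?groupM.
  case: (no_ext t) => //; last by rewrite tV.
  by rewrite groupM // (subsetP sHG) ?groupM.
(* If yH is uncovered, differs from xH and lies in Hx^-1H, then t = xh^-1 represents xH while t^-1
   represents yH, so the pair could be adjoined. *)
suffices [y /dcosetP[h [k [Hh Hk def_y]]] /andP[nTHy nxHy]] :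
    exists2 y, y \in dcoset H x^-1 & (y \notin T * H) && (x^-1 * y \notin H).
  pose t := x * h^-1.
  have tV : t^-1 = y * k^-1 by rewrite def_y mulgK invMg invgK.
  have nt : t \notin T * H by rewrite TH_HE ?groupV.
  case: (no_ext t) => //; first by rewrite groupM // (subsetP sHG) ?groupV.
    by rewrite tV TH_HE ?groupV.
  rewrite -groupV invMg => Htt; case/negP: nxHy.
  have -> : x^-1 * y = h^-1 * (t^-1 * t^-1) * k.
    by rewrite {2}tV /t invMg invgK !mulgA mulVg mul1g mulgKV.
  by rewrite (groupMr _ Hk) groupMl ?groupV.
apply/exists_inP; apply: contraT; rewrite negb_exists_in => /forall_inP/= allD.
have {}allD y : y \in dcoset H x^-1 -> y \notin T * H -> x^-1 * y \in H.
  by move=> /allD + nTHy; rewrite nTHy negbK.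
pose D := dcoset H x; pose D' := dcoset H x^-1.
have DV : D' = D^-1 by apply/setP=> y; rewrite mem_invg -dcosetV.
have TV' : T^-1 = T.
  apply/setP=> t; rewrite mem_invg; apply/idP/idP => [/TV|/TV //].
  by rewrite invgK.
have oTDV : #|T :&: D'| = #|T :&: D|.
  rewrite DV -{1}TV' -[RHS]card_invg; congr #|pred_of_set _|.
  by apply/setP=> t; rewrite !(inE, mem_invg).
have oTD z := card_partial_transversal_dcoset z trT.
(* If x is not in D', then T covers all of D'. Inversion matches T ∩ D with T ∩ D', so T covers
   equally much of D; but D has the size of D', and x is missed. *)
have [xD' | nxD'] := boolP (x \in D'); last first.
  have : #|D'| <= #|T * H :&: D'|.
    apply/subset_leq_card/subsetP=> y D'y; rewrite inE D'y andbT.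
    apply: contraR nxD' => nTHy; have Hxy := allD y D'y nTHy.
    by rewrite -(dcoset_mulr _ _ Hxy) mulKVg.
  rewrite oTD oTDV -oTD DV card_invg leqNgt => /negP[].
  apply/proper_card/properP; split; first exact: subsetIr.
  by exists x; rewrite ?dcoset_refl // inE (negPf nTHx).
have eqDD' : D' = D by rewrite /D' /D -(dcoset_eq xD').
(* Now D is self-inverse, and xH is the only left coset in D that T misses. *)
have oD : #|D| = (#|T :&: D|.+1 * #|H|)%N.
  rewrite mulSn -oTD -(cardsID (T * H) D) addnC [D :&: _]setIC; congr (_ + _)%N.
  rewrite -(card_lcoset H x); congr #|pred_of_set _|; apply/setP=> y.
  rewrite inE mem_lcoset; apply/andP/idP => [[nTHy Dy] | Hxy].
    by apply: allD; rewrite // -/D' eqDD'.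
  rewrite -(mulKVg x y) TH_HE // nTHx.
  by rewrite dcoset_mulr ?dcoset_refl.
have ix : #|H : H :&: H :^ x| = #|T :&: D|.+1.
  apply/eqP; rewrite -(eqn_pmul2r (cardG_gt0 (H :&: H :^ x))).
  rewrite mulnC Lagrange ?subsetIl // -(eqn_pmul2r (cardG_gt0 H)).
  by rewrite -(card_dcoset H x) -/D oD mulnAC.
(* If |T ∩ D| were odd, T ∩ D would contain an element of square 1. So D consists of an odd number
   of left cosets, and [invD] applies. *)
have evenTD : ~~ odd #|T :&: D|.
  apply: contra no_inv => oddTD.
  have [t|s /setIP[_ Ds] s2] := odd_invg_closed_involution _ oddTD.
    by rewrite !inE => /andP[/TV-> Dt]; rewrite -eqDD' -dcosetV invgK.
  by apply/exists_inP; exists s; rewrite ?s2.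
case/exists_inP: no_inv.
have [||s Ds s2] := invD x Gx; [by rewrite dcosetV|by rewrite ix|].
by exists s; rewrite ?s2.
Qed.

End Transversals.

(** * Reduction to Sylow 2-subgroups *)

Section SylowCriterion.

Variables (gT : finGroupType) (G H H2 N2 : {group gT}).
Hypotheses (sHG : H \subset G) (sylH2 : 2.-Sylow(H) H2).
Hypothesis sylN2 : 2.-Sylow('N_G(H2)) N2.

Lemma inverse_closed_transversal_coset_involution T :
    inverse_closed_transversal H G T ->
  {in N2, forall x, x ^+ 2 \in H2 ->
    exists2 h, h \in H2 & (x * h) ^+ 2 = 1}.
Proof.
case=> sTG TV trT sGTH x N2x H2x2.
have [sH2H pH2 _] := and3P sylH2.
have [/setIP[Gx nH2x] p2x] : x \in 'N_G(H2) /\ 2.-elt x.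
  split; first exact: (subsetP (pHall_sub sylN2)).
  exact: mem_p_elt (pHall_pgroup sylN2) N2x.
have [H2x | nH2x'] := boolP (x \in H2).
  by exists x^-1; rewrite ?groupV // mulgV expg1n.
have Hx2 := subsetP sH2H _ H2x2.
(* Since x^2 is in H, conjugation by x swaps H and H^x, so x normalizes K. The index |H : K| counts
   the left cosets in HxH, and is odd because K contains H2. *)
pose K := (H :&: H :^ x)%G.
have sKH : K \subset H := subsetIl _ _.
have sH2K : H2 \subset K.
  by rewrite subsetI sH2H -(normP nH2x) conjSg.
have nKx : x \in 'N(K).
  rewrite inE conjIg -conjsgM -expg2 (conjGid Hx2) setIC //.
have sylH2K : 2.-Sylow(K) H2 := pHall_subl sH2K sKH sylH2.
have oddHK : odd #|H : K|.
  have [_ _ H2'] := and3P sylH2; rewrite odd_2'nat (pnat_dvd _ H2') //.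
  by rewrite -(Lagrange_index sKH sH2K) dvdn_mulr.
have sDG : dcoset H x \subset G.
  apply/subsetP=> _ /dcosetP[h [k [/(subsetP sHG) Gh /(subsetP sHG) Gk ->]]].
  by rewrite !groupM.
have oddTD : odd #|T :&: dcoset H x|.
  have := card_dcoset H x.
  have {1}<- : T * H :&: dcoset H x = dcoset H x.
    by apply/setIidPr/(subset_trans sDG).
  rewrite card_partial_transversal_dcoset // mulnAC => /eqP.
  rewrite eqn_pmul2r // -(Lagrange sKH) mulnC eqn_pmul2l // => /eqP->.
  by [].
have Dx' : x^-1 \in dcoset H x.
  have -> : x^-1 = x * (x ^+ 2)^-1 by rewrite invMg mulKVg.
  by rewrite dcoset_mulr ?groupV ?dcoset_refl.
have [s0 /setIP[Ts0 Ds0]|s /setIP[_ Ds] s2] :=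
  odd_invg_closed_involution _ oddTD.
  by rewrite inE TV // dcosetV (dcoset_eq Dx').
have [h Hh t2] : exists2 h, h \in H & (h * x) ^+ 2 = 1.
  case/dcosetP: Ds => a [k [Ha Hk def_s]]; exists (k * a); rewrite ?groupM //.
  have -> : k * a * x = s ^ k^-1 by rewrite conjgE invgK def_s !mulgA mulgK.
  by rewrite -conjXg s2 conj1g.
have Kh : h \in K.
  rewrite inE Hh mem_conjg conjgE invgK mulgA.
  have -> : x * h * x^-1 = h^-1 * (x ^+ 2)^-1.
    have -> : h^-1 = x * h * x.
      apply/eqP; rewrite eq_invg_mul !mulgA -[_ * x]mulgA.
      by rewrite -[_ * _]/((h * x) ^+ 2) t2.
    by rewrite invMg mulgA mulgK.
  by rewrite groupM ?groupV.
(* A conjugate t^c lies in a Sylow 2-subgroup P of M containing H2 and x. As M / K is cyclic, t^c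
   and x agree modulo K, so x^-1 t^c lies in K ∩ P, which is H2. *)
pose t := h * x; pose M := K <*> <[x]>.
have Mx : x \in M by rewrite mem_gen // inE cycle_id orbT.
have sKM : K \subset M := joing_subl _ _.
have nKM : K <| M.
  by rewrite /normal sKM join_subG normG cycle_subG.
have sMK : M^`(1) \subset K.
  rewrite der1_min ?normal_norm //= quotientYidl ?cycle_subG //.
  by rewrite quotient_abelian ?cycle_abelian.
have [P sylP sP] : {P : {group gT} | 2.-Sylow(M) P & H2 <*> <[x]> \subset P}.
  apply: Sylow_superset.
    by rewrite join_subG (subset_trans sH2K) ?joing_subl ?joing_subr.
  by rewrite /= norm_joinEr ?cycle_subG // pgroupM pH2.
have [c Mc sP'] : exists2 c, c \in M & <[t]> :^ c \subset P.
  apply: Sylow_Jsub sylP _ _.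
    by rewrite cycle_subG groupM // (subsetP sKM).
  by apply: pnat_dvd (isT : 2.-nat 2); rewrite -orderE order_dvdn t2.
have Ptc : t ^ c \in P by rewrite (subsetP sP') // memJ_conjg cycle_id.
have Px : x \in P by rewrite (subsetP sP) // mem_gen // inE cycle_id orbT.
exists (x^-1 * t ^ c); last by rewrite mulKVg -conjXg t2 conj1g.
have Ktc : x^-1 * t ^ c \in K.
  rewrite conjg_mulR mulgA groupM -?conjgE ?memJ_norm //.
  by rewrite (subsetP sMK) // mem_commg // groupM // (subsetP sKM).
have KPtc : x^-1 * t ^ c \in K :&: P by rewrite in_setI Ktc groupM ?groupV.
have pKP : 2.-group (K :&: P) := pgroupS (subsetIr _ _) (pHall_pgroup sylP).
suffices <- : K :&: P = H2 by [].
apply: (sub_pHall sylH2K pKP _ (subsetIl _ _)).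
by rewrite subsetI sH2K (subset_trans (joing_subl _ _) sP).
Qed.

Lemma coset_involution_dcoset :
    {in N2, forall x, x ^+ 2 \in H2 ->
      exists2 h, h \in H2 & (x * h) ^+ 2 = 1} ->
  forall x, x \in G -> x^-1 \in dcoset H x -> odd #|H : H :&: H :^ x| ->
    exists2 s, s \in dcoset H x & s ^+ 2 = 1.
Proof.
move=> invN2 x Gx /dcosetP[h1 [h2 [Hh1 Hh2 def_xV]]] odd_x.
have [sH2H pH2 _] := and3P sylH2.
(* This representative of xH has its square in H, so it normalizes H ∩ H^g. *)
pose g := x * h2.
have Dg : g \in dcoset H x by rewrite dcoset_mulr ?dcoset_refl.
have Hg2 : g ^+ 2 \in H.
  have -> : g ^+ 2 = h1^-1 * h2.
    have -> : h1^-1 = x * h2 * x.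
      by apply/eqP; rewrite eq_invg_mul !mulgA -def_xV mulVg.
    by rewrite -[g ^+ 2]/(g * g) /g !mulgA.
  by rewrite groupM ?groupV.
have Gg : g \in G by rewrite groupM // (subsetP sHG).
pose K := (H :&: H :^ g)%G.
have sKH : K \subset H := subsetIl _ _.
have nKg : g \in 'N(K).
  by rewrite inE conjIg -conjsgM -[g * g]/(g ^+ 2) (conjGid Hg2) setIC.
have oddK : odd #|H : K|.
  suffices -> : #|H : K| = #|H : H :&: H :^ x| by [].
  have oK : #|K| = #|H :&: H :^ x|.
    have oD : 0 < #|dcoset H x|.
      by apply/card_gt0P; exists x; apply: dcoset_refl.
    apply/eqP; rewrite -(eqn_pmul2l oD) card_dcoset.
    by rewrite -(dcoset_eq Dg) card_dcoset.
  apply/eqP; rewrite -(eqn_pmul2l (cardG_gt0 K)) Lagrange // oK Lagrange //.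
  exact: subsetIl.
have Kg2 : g ^+ 2 \in K
  by rewrite inE Hg2 mem_conjg conjXg conjgE invgK mulgV mulg1.
(* A Frattini argument in K<g> moves g, modulo K, to a 2-element n2
   normalizing a Sylow 2-subgroup P of K, which is also one of H. *)
have [P sylP] := Sylow_exists 2 K.
have [sPK pP P2'] := and3P sylP.
have sylHP : 2.-Sylow(H) P.
  apply/and3P; split=> //; first exact: subset_trans sKH.
  by rewrite -(Lagrange_index sKH sPK) pnatM -odd_2'nat oddK P2'.
pose M := K <*> <[g]>.
have sKM : K \subset M := joing_subl _ _.
have Mg : g \in M by rewrite mem_gen // inE cycle_id orbT.
have nKM : K <| M by rewrite /normal sKM join_subG normG cycle_subG.
have : g \in K * 'N_M(P) by rewrite (Frattini_arg nKM sylP).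
case/mulsgP=> k n Kk /setIP[Mn nPn] def_g.
have nKn : n \in 'N(K) by rewrite (subsetP (normal_norm nKM)).
have nKk : k \in 'N(K) := subsetP (normG K) k Kk.
have cn2 : coset K n ^+ 2 = 1.
  suffices -> : coset K n = coset K g by rewrite -morphX //= coset_id.
  by rewrite def_g morphM //= (coset_id Kk) mul1g.
(* As n^2 lies in K, so does the odd part of n; hence the 2-part of n is still in HxH. *)
have Kn2' : n.`_(2^') \in K.
  apply: coset_idr; rewrite ?groupX // morph_constt //; apply/constt1P.
  by rewrite p_eltNK; apply: pnat_dvd (isT : 2.-nat 2); rewrite order_dvdn cn2.
pose n2 := n.`_2.
have p_n2 : 2.-elt n2 := p_elt_constt 2 n.
have nPn2 : n2 \in 'N(P) by rewrite groupX.
have def_n2 : n2 = k^-1 * g * (n.`_(2^'))^-1.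
  by apply: (mulIg n.`_(2^')); rewrite mulgKV consttC def_g mulKg.
have Dn2 : n2 \in dcoset H x.
  by rewrite def_n2 dcoset_mul ?groupV ?(subsetP sKH).
have Kn22 : n2 ^+ 2 \in K.
  apply: coset_idr; rewrite ?groupX // -expgM mulnC expgM morphX ?groupX //.
  by rewrite morphX // cn2 expg1n.
have Pn22 : n2 ^+ 2 \in P.
  have nPNK : P <| 'N_K(P) by rewrite normalSG.
  have sylNP := pHall_subl (normal_sub nPNK) (subsetIl K 'N(P)) sylP.
  have NPn22 : n2 ^+ 2 \in 'N_K(P) by rewrite in_setI Kn22 groupX.
  rewrite (mem_normal_Hall sylNP nPNK NPn22).
  exact: pnat_dvd (orderXdvd n2 2) p_n2.
have [y Hy defP] := Sylow_trans sylH2 sylHP.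
pose w := n2 ^ y^-1.
have Gw : w \in G.
  have Gy : y \in G := subsetP sHG y Hy.
  have sMG : M \subset G by rewrite join_subG cycle_subG Gg (subset_trans sKH).
  by rewrite groupJ ?groupV // groupX // (subsetP sMG).
have H2w2 : w ^+ 2 \in H2 by rewrite /w -conjXg -mem_conjg -defP.
have nH2w : w \in 'N(H2).
  by rewrite /w -mem_conjg -normJ -defP.
have Dw : w \in dcoset H x.
  by rewrite /w conjgE invgK mulgA dcoset_mul ?groupV.
(* Conjugation by z may leave HxH, so the element h found for w^z is conjugated back at the end. *)
have [z /setIP[Gz nH2z] N2w] :
    exists2 z, z \in 'N_G(H2) & <[w]> :^ z \subset N2.
  apply: Sylow_Jsub sylN2 _ _; first by rewrite cycle_subG inE Gw.
  by rewrite -[_.-group _]/(2.-elt w) p_eltJ.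
have N2wz : w ^ z \in N2 by rewrite (subsetP N2w) // memJ_conjg cycle_id.
have [|h H2h wzh] := invN2 _ N2wz.
  by rewrite -conjXg memJ_norm.
exists (w * h ^ z^-1).
  by rewrite dcoset_mulr // (subsetP sH2H) // memJ_norm // groupV.
by apply: (@conjg_inj _ z); rewrite conjXg conjMg conjgKV wzh conj1g.
Qed.

Lemma perfect_code_sylow_criterion :
  subgroup_perfect_code G H <->
  {in N2, forall x, x ^+ 2 \in H2 -> exists2 h, h \in H2 & (x * h) ^+ 2 = 1}.
Proof.
apply: iff_trans (perfect_code_transversal sHG) _; split=> [[T trT] | invN2].
  exact: inverse_closed_transversal_coset_involution trT.
apply: inverse_closed_transversal_exists => //.
exact: coset_involution_dcoset.
Qed.

End SylowCriterion.

(** * Extraspecial 2-groups *)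

(** Serves to pass from ['D_8] to the group [2^{1+2}] underlying ['D^m]. When every automorphism of
    Z(B) extends to B, the central product does not depend on how the centers are identified. *)
Lemma isog_ncprod (aT rT : finGroupType) (A : {group aT}) (B : {group rT}) n :
    Aut_in (Aut B) 'Z(B) \isog Aut 'Z(B) -> A \isog B ->
  [set: ncprod A n] \isog [set: ncprod B n].
Proof.
move=> AutZB isoAB; elim: n => [|n IHn].
  apply: isog_trans (ncprod0 A) (isog_trans _ (isog_symr (ncprod0 B))).
  have [f injf fA] := isogP isoAB; rewrite /= -fA.
  by rewrite -injm_center // sub_isog ?center_sub.
case: (ncprodS B n) => gz isoZ; case: (ncprodS A n) => gz' isoZ'.
apply: (isog_cprod_by isoZ (im_cpair_cprod isoZ') (setI_im_cpair isoZ')) => //.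
  by apply: isog_trans _ isoAB; rewrite isog_sym sub_isog ?injm_cpairg1.
by apply: isog_trans _ IHn; rewrite isog_sym sub_isog ?injm_cpair1g.
Qed.

Lemma isog_Gm1 m : [set: Gm1 m] \isog 'D^m.
Proof.
apply: isog_ncprod; last by rewrite isog_sym isog_2X1p2.
exact: Aut_extraspecial_full (pX1p2_pgroup _) (pX1p2_extraspecial _).
Qed.

(** Of the two extraspecial groups of this order, D_8 o ... o D_8 has 2-rank m + 1 and the other has
    2-rank m. *)
Lemma isog_Gm1_rank (gT : finGroupType) (Q : {group gT}) m :
    0 < m -> extraspecial Q -> #|Q| = (2 ^ (2 * m + 1))%N ->
  (Q \isog [set: Gm1 m]) = (m < 'r_2(Q)).
Proof.
rewrite mul2n addn1 => m_gt0 esQ oQ; apply/idP/idP => [isoQ | rQ].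
  by rewrite (isog_p_rank (isog_trans isoQ (isog_Gm1 m))) rank_Dn.
apply: isog_trans (isog_symr (isog_Gm1 m)).
have [//| isoQ] := isog_2extraspecial oQ esQ.
by rewrite (isog_p_rank isoQ) rank_DnQ prednK ?ltnn in rQ.
Qed.

(** * The squaring form and the coset condition *)

Section ExtraspecialTwoGroup.

Variables (gT : finGroupType) (Q : {group gT}).
Hypotheses (pQ : 2.-group Q) (esQ : extraspecial Q).

Let Z := 'Z(Q).
Let oZ : #|Z| = 2 := card_center_extraspecial pQ esQ.

(* On Q / Z(Q), seen as a vector space over F_2, [q] is the quadratic form
   given by squaring and [b], given by commutators, is its polar form. *)
Let q (x : gT) : bool := x ^+ 2 != 1.
Let b (x y : gT) : bool := [~ x, y] != 1.

Lemma extraspecial2_expg2 : {in Q, forall x, x ^+ 2 \in 'Z(Q)}.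
Proof.
move=> x Qx; case: esQ => [[<- _] _]; rewrite (Phi_joing pQ) mem_gen //.
by rewrite inE orbC (Mho_p_elt 1) // (mem_p_elt pQ).
Qed.

Lemma extraspecial_commg : {in Q &, forall x y, [~ x, y] \in 'Z(Q)}.
Proof. by move=> x y Qx Qy; case: esQ => [[_ <-] _]; apply: mem_commg. Qed.

Let sqZ := extraspecial2_expg2.
Let commZ := extraspecial_commg.

(** Z has a single nontrivial element, so [_ != 1] identifies Z with the additive group of F_2. *)
Let mulZ : {in Z &, forall y z, (y * z != 1) = (y != 1) (+) (z != 1)}.
Proof.
have /eqP/cards1P[t Zt] : #|Z^#| = 1%N.
  by have := cardsD1 1 Z; rewrite oZ group1 => -[].
have ZE y : y \in Z -> y != 1 -> y = t.
  by move=> Zy nty; apply/set1P; rewrite -Zt in_setD1 nty.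
move=> y z Zy Zz; have [->|nty] := eqVneq y 1; first by rewrite mul1g.
have [->|ntz] := eqVneq z 1; first by rewrite mulg1 nty.
apply: contraTF isT => ntyz.
move: (ntyz); rewrite (ZE _ _ ntyz) ?groupM // => ntt.
have := ZE _ (groupM Zy Zz) ntyz; rewrite (ZE y) // (ZE z) // => /eqP.
by rewrite -{3}(mulg1 t) (inj_eq (mulgI t)) (negPf ntt).
Qed.

Let cZ y x : y \in Z -> x \in Q -> commute x y.
Proof. by case/setIP=> _ /centP cQy Qx; apply/commute_sym/cQy. Qed.

Let bC x y : b x y = b y x.
Proof. by rewrite /b -invg_comm eq_invg1. Qed.

Let bMl : {in Q & & Q, forall x y z, b (x * y) z = b x z (+) b y z}.
Proof.
move=> x y z Qx Qy Qz; rewrite /b commMgJ conjgE -(cZ (commZ Qx Qz) Qy) mulKg.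
by rewrite mulZ ?commZ.
Qed.

Let bMr : {in Q & & Q, forall x y z, b x (y * z) = b x y (+) b x z}.
Proof. by move=> x y z Qx Qy Qz; rewrite !(bC x) bMl. Qed.

Let qM : {in Q &, forall x y, q (x * y) = q x (+) q y (+) b x y}.
Proof.
move=> x y Qx Qy; have [Zc Zc'] := (commZ Qx Qy, commZ Qy Qx).
rewrite bC /q expMg_Rmul; [|exact: cZ Zc' Qy|exact: cZ Zc' Qx].
rewrite (mulZ (groupM (sqZ Qx) (sqZ Qy)) (groupX _ Zc')).
by rewrite (mulZ (sqZ Qx) (sqZ Qy)).
Qed.

Let bE x y : b x y = (x \notin 'C[y]).
Proof. by rewrite /b (sameP commgP cent1P). Qed.

(* The values of q at x, xu, xw and xuw sum to b(u,w), which is 1. *)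
Lemma coset_involution_nonabelian (H : {group gT}) :
    H \subset Q -> ~~ abelian H ->
  {in Q, forall x, exists2 h, h \in H & (x * h) ^+ 2 = 1}.
Proof.
move=> sHQ /subsetPn[u Hu]; rewrite -sub_cent1 => /subsetPn[w Hw cu'w] x Qx.
have buw : b u w by rewrite bC bE.
have [Qu Qw] := (subsetP sHQ u Hu, subsetP sHQ w Hw).
suffices [h Hh /negbFE/eqP xh1] : exists2 h, h \in H & q (x * h) = false.
  by exists h.
have := qM Qx (groupM Qu Qw); rewrite (qM Qu Qw) (bMr Qx Qu Qw) buw.
have := qM Qx Qu; have := qM Qx Qw.
case qxu: (q (x * u)); last by exists u.
case qxw: (q (x * w)); last by exists w.
case qxuw: (q (x * (u * w))); last by exists (u * w); rewrite ?groupM.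
case qx: (q x); last by exists 1; rewrite ?mulg1.
by do 2!case: (q _) => //; do 2!case: (b x _).
Qed.

(** Nondegeneracy of b: the dimensions of a subspace of Q / Z and of its orthogonal add up to that
    of Q / Z. *)
Let card_cent (U : {group gT}) :
  Z \subset U -> U \subset Q -> (#|'C_Q(U)| * #|U| = 2 * #|Q|)%N.
Proof.
move=> sZU sUQ; rewrite (card_subcent_extraspecial pQ) // (setIidPl sZU) oZ.
by rewrite -mulnA [(#|_ : _| * _)%N]mulnC Lagrange.
Qed.

Let qZ z : z \in Z -> q z = false.
Proof. by move=> Zz; rewrite /q -oZ expg_cardG ?eqxx. Qed.

Let b_cent (U : {group gT}) x u : x \in 'C(U) -> u \in U -> b x u = false.
Proof.
by move=> /centP cUx /cUx cxu; apply/negbTE; rewrite negbK; apply/commgP.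
Qed.

Let abelianb (U : {group gT}) :
  abelian U -> {in U &, forall x y, b x y = false}.
Proof. by move=> cUU x y Ux Uy; rewrite (b_cent (subsetP cUU x Ux)). Qed.

(* On the abelian group H the form q is linear, hence of the form b(x,.). *)
Lemma square_commutator_witness (H : {group gT}) :
    'Z(Q) \subset H -> H \subset Q -> abelian H ->
  exists2 x, x \in Q & {in H, forall h, b x h = q h}.
Proof.
move=> sZH sHQ cHH; have QH := subsetP sHQ.
have bH := abelianb cHH.
pose A := [set h in H | ~~ q h].
have gA : group_set A.
  apply/group_setP; split=> [|x y]; first by rewrite !inE group1 /q expg1n eqxx.
  rewrite !inE => /andP[Hx /negbTE qx] /andP[Hy /negbTE qy].
  by rewrite groupM // qM ?QH // qx qy bH.
pose H0 := Group gA; have sH0H : H0 \subset H by apply/subsetP=> h /setIdP[].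
have sZH0 : Z \subset H0.
  by apply/subsetP=> z Zz; rewrite inE (subsetP sZH) ?qZ.
have [sHH0|] := boolP (H \subset H0).
  exists 1 => // h Hh; rewrite bC bE cent11T inE.
  by have:= subsetP sHH0 h Hh; rewrite inE => /andP[_ /negbTE->].
move=> nsHH0; have ltH0H : (#|H0| < #|H|)%N.
  by rewrite proper_card // properE sH0H.
(* The kernel H0 of q on H is proper, so more elements centralize it than centralize H. For x among
   the extra ones, b(x,.) is nonzero on H and vanishes on H0, of index 2, so it equals q. *)
have : ~~ ('C_Q(H0) \subset 'C_Q(H)).
  apply: contraL ltH0H => /subset_leq_card leC; rewrite -leqNgt.
  rewrite -(leq_pmul2l (cardG_gt0 'C_Q(H))) card_cent //.
  by rewrite -(card_cent sZH0 (subset_trans sH0H sHQ)) leq_mul2r leC orbT.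
case/subsetPn=> x /setIP[Qx cH0x]; rewrite inE Qx /= -sub_cent1.
case/subsetPn=> u Hu; rewrite -bE bC => bxu; exists x => // h Hh.
have bx0 y : y \in H -> q y = false -> b x y = false.
  by move=> Hy qy; apply: (b_cent cH0x); rewrite inE Hy qy.
have [qh | /negbTE qh] := boolP (q h); last exact: bx0.
have qu : q u by apply: contraTT bxu => /negbTE/(bx0 u Hu)->.
have /bx0: h * u \in H by rewrite groupM.
rewrite qM ?QH // qh qu bH // (bMr Qx (QH h Hh) (QH u Hu)) bxu.
by case: (b x h) => // /(_ erefl).
Qed.

Lemma involutions_in_cosets_bound (H : {group gT}) :
    'Z(Q) \subset H -> H \subset Q -> abelian H ->
    {in Q, forall x, exists2 h, h \in H & (x * h) ^+ 2 = 1} ->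
  (#|H| ^ 2 = 2 * #|Q|)%N
  /\ exists E : {group gT}, [/\ E \subset Q, 2.-abelem E & #|H| <= #|E|].
Proof.
move=> sZH sHQ cHH invH; have QH := subsetP sHQ.
have bH := abelianb cHH.
have [x Qx bxq] := square_commutator_witness sZH sHQ cHH.
(* By the choice of x, q is constant on each coset xwH, and some element there has q = 0. *)
have qxw : {in 'C_Q(H), forall w, q (x * w) = false}.
  move=> w /setIP[Qw cHw]; have [h Hh /eqP] := invH _ (groupM Qx Qw).
  rewrite -[_ == _]negbK => /negbTE; rewrite -/(q _).
  rewrite (qM (groupM Qx Qw) (QH h Hh)) (bMl Qx Qw (QH h Hh)).
  by rewrite bxq // (b_cent cHw Hh) addbF addbK.
have qx : q x = false by rewrite -(mulg1 x) qxw ?group1.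
have bxA : {in 'C_Q(H), forall w, b x w = q w}.
  move=> w Aw; have Qw := subsetP (subsetIl _ _) w Aw.
  have := qxw w Aw; rewrite qM // qx /=; by case: (q w); case: (b x w).
have cAA : abelian 'C_Q(H).
  apply/subsetP=> w Aw; apply/centP=> v Av; apply/commgP.
  have [Qw Qv] := (subsetP (subsetIl _ _) w Aw, subsetP (subsetIl _ _) v Av).
  have := bxA _ (groupM Aw Av); rewrite bMr // !bxA // qM //.
  by rewrite -[_ == 1]negbK -/(b w v); case: (q w); case: (q v); case: (b w v).
have sHA : H \subset 'C_Q(H) by rewrite subsetI sHQ.
have sAQ : 'C_Q(H) \subset Q := subsetIl _ _.
(* The order formula for H and for its self-centralizing centralizer A gives |A||A| = |A||H|. *)
have defA : 'C_Q('C_Q(H)) = 'C_Q(H).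
  by apply/eqP; rewrite eqEsubset setIS ?centS //= subsetI sAQ.
have oA := card_cent (subset_trans sZH sHA) sAQ.
rewrite /= defA -(card_cent sZH sHQ) in oA.
have {}oA : #|'C_Q(H)| = #|H|.
  by apply/eqP; rewrite -(eqn_pmul2l (cardG_gt0 'C_Q(H))) oA.
split; first by rewrite -(card_cent sZH sHQ) oA mulnn.
have abelem2 (U : {group gT}) :
    U \subset H -> {in U, forall u, q u = false} -> 2.-abelem U.
  move=> sUH qU; rewrite abelemE // (abelianS sUH cHH) /=.
  by apply/exponentP=> u /qU/negbFE/eqP.
have [allq | ] := boolP [forall h in H, ~~ q h].
  by exists H; split=> //; apply: abelem2 => // h /(forall_inP allq)/negbTE.
rewrite negb_forall_in => /exists_inP[u Hu]; rewrite negbK => qu.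
(* When q is nonzero on H, its kernel there is C_H(x), which has index at most 2. The involution x
   outside H makes up for the loss, and E = C_H(x) × <x>. *)
have nHx : x \notin H by apply: contraL qu => Hx; rewrite -bxq // bH.
have ox : #[x] = 2.
  apply: nt_prime_order => //; first by apply/eqP/negbFE.
  by apply: contraNneq nHx => ->; rewrite group1.
have defE : 'C_H[x] \x <[x]> = 'C_H[x] <*> <[x]>.
  rewrite dprodEY //; first by rewrite cycle_subG -sub_cent1 subsetIr.
  by rewrite setIC prime_TIg -?orderE ?ox // cycle_subG inE (negbTE nHx).
exists ('C_H[x] <*> <[x]>)%G; split.
- by rewrite join_subG cycle_subG Qx subIset ?sHQ.
- have abelx : 2.-abelem <[x]> by rewrite prime_abelem -?orderE ?ox.
  rewrite (dprod_abelem _ defE) abelx andbT.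
  apply: abelem2 (subsetIl _ _) _ => h /setIP[Hh cxh].
  by rewrite -bxq // bC bE cxh.
rewrite -(dprod_card defE) -orderE ox muln2 -addnn.
have qV : q u^-1 = true by rewrite /q expgVn eq_invg1.
have : H \subset 'C_H[x] :|: 'C_H[x] :* u.
  apply/subsetP=> h Hh; have HhV := groupM Hh (groupVr Hu).
  rewrite in_setU mem_rcoset !in_setI Hh HhV /=.
  have := bxq _ HhV; rewrite (qM (QH h Hh) (groupVr (QH u Hu))) qV.
  rewrite (bH _ _ Hh (groupVr Hu)) addbF addbT -bxq //.
  by rewrite ![b x _]bC !bE => /negbRL ->; case: (h \in _).
move/subset_leq_card/leq_trans; apply; rewrite -(card_rcoset 'C_H[x] u).
by rewrite (leq_trans (leq_card_setU _ _)) // card_rcoset.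
Qed.

Lemma coset_involution_maximal_abelian (H E : {group gT}) :
    'Z(Q) \subset H -> H \subset Q -> abelian H -> (#|H| ^ 2 = 2 * #|Q|)%N ->
    E \subset Q -> 2.-abelem E -> #|H| <= #|E| ->
  {in Q, forall x, exists2 h, h \in H & (x * h) ^+ 2 = 1}.
Proof.
move=> sZH sHQ cHH oH sEQ abelE leHE x Qx; have QH := subsetP sHQ.
have bH := abelianb cHH.
have oCH : #|'C_Q(H)| = #|H|.
  by apply/eqP; rewrite -(eqn_pmul2r (cardG_gt0 H)) card_cent // mulnn oH.
have defH : 'C_Q(H) = H.
  have sHC : H \subset 'C_Q(H) by rewrite subsetI sHQ.
  by apply/eqP; rewrite eq_sym eqEcard sHC oCH leqnn.
suffices /exists_inP[h Hh xh1] : [exists h in H, (x * h) ^+ 2 == 1].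
  by exists h => //; apply/eqP.
(* If no element of xH has square 1, then q(x) = 1 and b(x,.) = q on H; this will force |E| <
   |H|. *)
apply: contraLR leHE; rewrite negb_exists_in => /forall_inP/= qxh.
have {}qxh h : h \in H -> q (x * h) by apply: qxh.
have qx : q x by rewrite -(mulg1 x) qxh.
have bxq h : h \in H -> b x h = q h.
  move=> Hh; have := qxh h Hh; rewrite (qM Qx (QH h Hh)) qx;
  by case: (q h); case: (b x h).
have H0P h : (h \in 'C_H[x]) = (h \in H) && ~~ q h.
  by rewrite in_setI; apply: andb_id2l => /bxq <-; rewrite bC bE negbK.
have [u Hu bxu] : exists2 u, u \in H & b x u.
  have : x \notin H.
    apply/negP=> Hx; have := qxh _ (groupVr Hx).
    by rewrite mulgV /q expg1n eqxx.
  rewrite -{1}defH inE Qx -sub_cent1 => /subsetPn[u Hu].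
  by rewrite -bE bC; exists u.
have qu : q u by rewrite -bxq.
have sH0Q : 'C_H[x] \subset Q by rewrite subIset ?sHQ.
have sZH0 : Z \subset 'C_H[x].
  by apply/subsetP=> z Zz; rewrite H0P (subsetP sZH) ?qZ.
(* H is generated by H0 = C_H[x] and u, and H is its own centralizer in Q. *)
have inH y : y \in 'C_Q('C_H[x]) -> b y u = false -> y \in H.
  case/setIP=> Qy cH0y byu; rewrite -defH inE Qy -sub_cent1.
  apply/subsetP=> h Hh; rewrite -[_ \in _]negbK -bE bC.
  have [qh | qh] := boolP (q h); last by rewrite (b_cent cH0y) // H0P Hh.
  have: b y (h * u) = false.
    apply: b_cent cH0y _.
    by rewrite H0P groupM // (qM (QH h Hh) (QH u Hu)) qh qu bH.
  by rewrite (bMr Qy (QH h Hh) (QH u Hu)) byu addbF => ->.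
(* If y did not commute with u, then x^-1 y would commute with H0 and u, hence lie in H, and y in xH
   would have q(y) = 1. *)
have H0inv y : y \in 'C_Q('C_H[x]) -> q y = false -> y \in 'C_H[x].
  move=> Cy qy; have [Qy cH0y] := setIP Cy; rewrite H0P qy andbT.
  apply: (inH y) => //; apply/negbTE/negP => byu.
  have : x^-1 * y \in H.
    apply: (inH (x^-1 * y)); last first.
      rewrite (bMl (groupVr Qx) Qy (QH u Hu)) byu.
      suffices -> : b x^-1 u = b x u by rewrite bxu.
      by rewrite !bE groupV.
    rewrite groupM // inE groupV Qx groupV -sub_cent1 subsetIr //.
  by move/qxh; rewrite mulKVg qy.
have ltH0H : #|'C_H[x]| < #|H|.
  apply/proper_card/properP; split; first exact: subsetIl.
  by exists u => //; rewrite H0P qu andbF.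
rewrite -ltnNge; apply: leq_ltn_trans ltH0H.
(* Counting centralizers of H0 = C_H[x] and S gives |E| <= |H0|: E meets
   C_Q(H0) in S, and the product E C_Q(H0) centralizes S. *)
set S := E :&: 'C_H[x].
have sSQ : S \subset Q by rewrite subIset ?sEQ.
have cEE := abelem_abelian abelE.
have sDS : E :&: 'C_Q('C_H[x]) \subset S.
  apply/subsetP=> y /setIP[Ey Dy]; rewrite inE Ey H0inv //.
  by have [_ /(_ y Ey) y2] := abelemP (isT : prime 2) abelE; rewrite /q y2 eqxx.
have sEDC : E * 'C_Q('C_H[x]) \subset 'C_Q(S).
  rewrite mul_subG // ?setIS ?centS ?subsetIr // subsetI sEQ centsC.
  exact: subset_trans (subsetIl _ _) cEE.
rewrite -(leq_pmul2r (cardG_gt0 'C_Q('C_H[x]))) mul_cardG.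
rewrite [leqRHS]mulnC card_cent //.
apply: leq_trans (leq_mul (subset_leq_card sEDC) (subset_leq_card sDS)) _.
(* S need not contain Z, but |Z ∩ S| <= 2 is enough for the bound. *)
rewrite (card_subcent_extraspecial pQ) // -mulnA [(#|_ : _| * _)%N]mulnC.
rewrite Lagrange //.
by rewrite leq_mul2r -[leqRHS]oZ subset_leq_card ?orbT ?subsetIl.
Qed.

End ExtraspecialTwoGroup.

(** * The criterion inside an extraspecial Sylow subgroup *)

Theorem theorem1p3 (gT : finGroupType) (G : {group gT}) (m : nat)
    (m_ge1 : (1 <= m)%N)
    (sylG : forall P : {group gT}, 2.-Sylow(G) P ->
      extraspecial P /\ #|P| = (2 ^ (2 * m + 1))%N)
    (H : {group gT}) (sHG : H \subset G)
    (G2 : {group gT}) (sylG2 : 2.-Sylow(G) G2)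
    (H2 : {group gT}) (sylH2 : 2.-Sylow(H) H2)
    (N2 : {group gT}) (sylN2 : 2.-Sylow('N_G(H2)) N2) :
  subgroup_perfect_code G H <->
  odd #|H| \/
  [\/ ~~ abelian H2,
      abelian H2 /\ (#|N2| < #|G2|)%N
    | [/\ abelian H2, (#|H2| ^ 2 = 2 * #|G2|)%N & G2 \isog [set: Gm1 m]]].
Proof.
apply: iff_trans (perfect_code_sylow_criterion sHG sylH2 sylN2) _.
have [sH2H pH2 H2'] := and3P sylH2.
have [/subsetIP[sN2G nH2N2] pN2 _] := and3P sylN2.
have sH2N2 : H2 \subset N2.
  apply: normal_sub_max_pgroup (Hall_max sylN2) pH2 _.
  by rewrite normalSG // (subset_trans sH2H).
(* G2 need not contain N2, so the argument runs in a conjugate Q of G2 that does. *)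
have [Q sylQ sN2Q] := Sylow_superset sN2G pN2.
have [esQ oQ] := sylG Q sylQ; have pQ := pHall_pgroup sylQ.
have sH2Q := subset_trans sH2N2 sN2Q.
have [x _ defG2] := Sylow_trans sylQ sylG2.
have -> : #|G2| = #|Q| by rewrite defG2 cardJg.
have -> : (G2 \isog [set: Gm1 m]) = (m < 'r_2(Q)).
  rewrite -(isog_Gm1_rank m_ge1 esQ oQ) defG2; apply: isog_transl.
  by rewrite isog_sym conj_isog.
have H2expn : (#|H2| ^ 2 = 2 * #|Q|)%N -> #|H2| = (2 ^ m.+1)%N.
  have eq_exp : (2 * m + 1).+1 = (m.+1 * 2)%N.
    by rewrite (mulSn m) mulnC addn1 add2n.
  by move/eqP; rewrite oQ -expnS eq_exp expnM eqn_exp2r // => /eqP.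
have [cH2 | ncH2] := boolP (abelian H2); last first.
  split=> [_ | _ y /(subsetP sN2Q) Qy _]; first by right; constructor 1.
  exact: coset_involution_nonabelian pQ esQ _ sH2Q ncH2 y Qy.
have [ltN2Q | leQN2] := ltnP #|N2| #|Q|.
  split=> [_ | _ y N2y H2y2]; first by right; constructor 2.
  (* A nontrivial y^2 in H2 is central in Q, so H2 contains Z(Q), which is the derived subgroup.
     Then Q normalizes H2, and |Q| <= |N2|. *)
  exists 1 => //; rewrite mulg1; apply/eqP; apply: contraTT ltN2Q => nt_y2.
  have Qy := subsetP sN2Q y N2y.
  have sZH2 : 'Z(Q) \subset H2.
    apply: contraR nt_y2 => nsZH2; apply/eqP/set1gP.
    rewrite -(prime_TIg _ nsZH2) ?(card_center_extraspecial pQ esQ) //.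
    by rewrite in_setI extraspecial2_expg2.
  have nH2Q : Q \subset 'N_G(H2).
    rewrite subsetI (pHall_sub sylQ); apply: sub_der1_norm sH2Q.
    by have [[_ ->] _] := esQ.
  rewrite -leqNgt.
  by rewrite (card_Hall sylN2) -(part_pnat_id pQ) dvdn_leq // partn_dvd ?cardSg.
have defN2 : N2 :=: Q by apply/eqP; rewrite eqEcard sN2Q.
rewrite defN2 in nH2N2 sH2N2 *.
have [H2_1 | ntH2] := eqVneq (H2 : {set gT}) 1.
  split=> [_ | _ y _ ]; last first.
    by rewrite H2_1 => /set1P y2; exists 1; rewrite ?mulg1 ?set11.
  by left; move: H2'; rewrite H2_1 indexg1 -odd_2'nat.
have sZH2 : 'Z(Q) \subset H2.
  apply: contraR ntH2 => nsZH2; apply/eqP.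
  apply: TI_center_nil (pgroup_nil pQ) _ _; first by rewrite /normal sH2Q.
  rewrite setIC; apply: prime_TIg nsZH2.
  by rewrite (card_center_extraspecial pQ esQ).
split=> [invQ | [oddH | [// | [_ //] | [_ oH2 rQ]]]].
- right; constructor 3.
  have sq_x y : y \in Q -> exists2 h, h \in H2 & (y * h) ^+ 2 = 1.
    move=> Qy; apply: invQ => //; apply: (subsetP sZH2).
    exact: extraspecial2_expg2.
  have [oH2 [E [sEQ abelE leH2E]]] :=
    involutions_in_cosets_bound pQ esQ sZH2 sH2Q cH2 sq_x.
  (* Since |E| >= |H2| = 2^(m+1), the 2-rank of Q exceeds m. *)
  split=> //; apply: leq_trans (logn_le_p_rank (_ : E \in 'E_2(Q))); last first.
    by apply/pElemP.
  rewrite -(leq_exp2l _ _ (isT : 1 < 2)) -H2expn //.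
  by rewrite -(card_pgroup (abelem_pgroup abelE)).
- case/eqP: ntH2; apply: card1_trivg.
  have odd1 : odd #|H2| by apply: dvdn_odd (cardSg sH2H) oddH.
  by move: odd1; rewrite (card_pgroup pH2) oddX orbF => /eqP->.
have [E /pnElemP[sEQ abelE dimE]] := p_rank_witness 2 Q.
move=> y Qy _; apply: (coset_involution_maximal_abelian pQ esQ (E := E)) => //.
by rewrite (card_pgroup (abelem_pgroup abelE)) dimE H2expn // leq_exp2l.
Qed.
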